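(* For every $f\in\mathcal{H}$ there exists a unique $G_f\in\mathcal{A}_1^1$ such that \[ \widetilde{S(f)}(z_s^{\delta}w)=z_s^{\delta}\,(G_f\diamond_s w) \] holds for every $s\in\mu_r$ and every $w\in\mathcal{A}_r$, where $S$ is the antipode of $\mathcal{H}$.
   Context: Fix an integer $r\ge 1$ and let $\mu_r$ be the set of $r$th roots of unity in $\mathbb{C}$. Let $\mathcal{A}_r=\mathbb{Q}\langle x,y_s\mid s\in\mu_r\rangle$ be the free noncommutative polynomial algebra over $\mathbb{Q}$ on the letters $x$ and $y_s$ ($s\in\mu_r$). Write $y=y_1$, $z=x+y_1$, $z_s=x+y_s$, $\delta(1)=0$ and $\delta(s)=1$ for $s\neq 1$, $z_s^{\delta}=x+\delta(s)y_s$, and $z_{k,s}=x^{k-1}y_s$ ($k\ge1$). Let $\mathcal{A}_1=\mathbb{Q}\langle x,y\rangle\subset\mathcal{A}_r$ and $\mathcal{A}_1^1=\mathbb{Q}\oplus\mathcal{A}_1y$. $R_w$ denotes right multiplication by $w$, and $R_w^{-1}$ removal of a final factor $w$. Let $\varphi$ be the algebra automorphism of $\mathcal{A}_r$ with $\varphi(x)=z$, $\varphi(y_s)=\delta(s)y_s-y_1$. Every word is uniquely $z_{k_1,s_1}\cdots z_{k_l,s_l}x^a$ ($l,a\ge0$); define linear maps $\mathcal{I}(z_{k_1,s_1}\cdots z_{k_l,s_l}x^a)=z_{k_1,s_1}z_{k_2,s_1s_2}\cdots z_{k_l,s_1\cdots s_l}x^a$ and $M_s(z_{k_1,s_1}\cdots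 z_{k_l,s_l}x^a)=z_{k_1,ss_1}z_{k_2,s_2}\cdots z_{k_l,s_l}x^a$ (with $M_s(x^a)=x^a$), and $\psi_s=\varphi\circ\mathcal{I}\circ M_s$. Diamond product: for $s\in\mu_r$, $\diamond_s:\mathcal{A}_1\times\mathcal{A}_r\to\mathcal{A}_r$ is the $\mathbb{Q}$-bilinear map defined recursively on words by $1\diamond_s w=w$, $v\diamond_s1=\psi_s\varphi(v)$, and for $v\in\mathcal{A}_1$, $w\in\mathcal{A}_r$, $1\ne t\in\mu_r$: $vx\diamond_s wx=(v\diamond_s wx)x-(vy\diamond_s w)x$; $vy\diamond_s wx=(v\diamond_s wx)y+(vy\diamond_s w)x$; $vx\diamond_s wy=(v\diamond_s wy)x+(vx\diamond_s w)y$; $vy\diamond_s wy=(v\diamond_s wy)y-(vx\diamond_s w)y$; $vx\diamond_s wy_t=(v\diamond_s wy_t)x+(v\diamond_s wz_t)y_t-(vy\diamond_s w)y_t$; $vy\diamond_s wy_t=(v\diamond_s wy_t)y-(v\diamond_s wz_t)y_t+(vy\diamond_s w)y_t$. Rooted trees: $\mathcal{H}$ is the Connes–Kreimer Hopf algebra over $\mathbb{Q}$: the commutative polynomial algebra on (non-planar) rooted trees, with basis the rooted forests and unit the empty forest $\mathbb{I}$; $\bullet$ is the one-vertex tree. $B_+$ sends a forest to the tree obtained by attaching all its roots to a new root ($B_+(\mathbb{I})=\bullet$). The coproduct $\Delta$ is the algebra map with $\Delta(\mathbb{I})=\mathbb{I}\otimes\mathbb{I}$ and $\Delta(B_+(f))=B_+(f)\otimes\mathbb{I}+(\mathrm{id}\otimes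 B_+)\Delta(f)$; the counit kills nonempty forests; the antipode $S$ is the algebra anti-automorphism with $m(S\otimes\mathrm{id})\Delta=m(\mathrm{id}\otimes S)\Delta=\mathbb{I}\cdot\varepsilon$. Write $\Delta(f)=\sum_{(f)}f'\otimes f''$. Rooted tree maps: $\widetilde{\mathbb{I}}=\mathrm{id}$, and for each forest $f\ne\mathbb{I}$ the linear map $\widetilde{f}:\mathcal{A}_r\to\mathcal{A}_r$ is determined by $\widetilde f(1)=0$ and: (I) $\widetilde{\bullet}(z_s^\delta)=z_s^\delta(z-z_s^\delta)$, $\widetilde{\bullet}(z)=0$; (II) for a forest $f\ne\mathbb{I}$, $\widetilde{B_+(f)}(z_s^\delta)=R_{z-z_s^\delta}R_{2z-z_s^\delta}R_{z-z_s^\delta}^{-1}\widetilde f(z_s^\delta)$ and $\widetilde{B_+(f)}(z)=0$; (III) if $f=gh$, $\widetilde f(v)=\widetilde g(\widetilde h(v))$ for $v\in\{z,z_s^\delta\mid s\in\mu_r\}$; (IV) $\widetilde f(wv)=\sum_{(f)}\widetilde{f'}(w)\widetilde{f''}(v)$ for $w\in\mathcal{A}_r$, $v\in\{z,z_s^\delta\mid s\in\mu_r\}$. These are well defined and $f\mapsto\widetilde f$ extends linearly to an algebra homomorphism $\mathcal{H}\to\mathrm{End}_{\mathbb{Q}}(\mathcal{A}_r)$. *)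

(* Defs.v *)
From HB Require Import structures.
From mathcomp Require Import all_boot all_algebra.
From mathcomp Require Import finmap.
From mathcomp.multinomials Require Import monalg.
From Stdlib Require Import ClassicalEpsilon.

Set Implicit Arguments.
Unset Strict Implicit.
Unset Printing Implicit Defensive.

Import GRing.Theory.
Local Open Scope ring_scope.

(* Roots of unity.  Throughout r = n.+1 (r >= 1).  The group mu_r is    *)
(* represented through exponents: s : 'I_r stands for exp(2 i pi s/r), *)
(* so that the product of roots of unity is the addition of 'I_n.+1   *)
(* (i.e. Z/rZ) and the root 1 is the exponent 0.                        *)
Notation mu n := 'I_n.+1.

Definition delta n (s : mu n) : rat := if s == 0 then 0 else 1.

(* Letters of A_r: None = x, Some s = y_s. *)
Notation letter n := (option (mu n)).
Notation word n := (seq (letter n)).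

(* A_r = Q<x, y_s | s in mu_r>, the free noncommutative Q-algebra: the
   monoid algebra over Q of the free monoid on the letters. *)
Definition Ar n := {malg rat[{fmonom (letter n)}]}.

Definition wrd n (u : word n) : Ar n := << FMonom u >>.
Definition X n : Ar n := wrd [:: None].
Definition Y n (s : mu n) : Ar n := wrd [:: Some s].
Definition Z n : Ar n := X n + Y 0.
Definition Zd n (s : mu n) : Ar n := X n + delta s *: Y s.
Definition Zs n (s : mu n) : Ar n := X n + Y s.

Definition lin n (F : word n -> Ar n) (p : Ar n) : Ar n :=
  \sum_(k <- msupp p) p@_k *: F (fmonom_val k).

(* A_1^1 = Q + A_1 y : every word of the support is written in x, y = y_1
   and is either empty or ends with y. *)
Definition inA11 n (p : Ar n) : Prop :=
  forall k : {fmonom (letter n)}, k \in msupp p ->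
    all (fun l => (l == None) || (l == Some 0)) (fmonom_val k) /\
    (fmonom_val k = [::] \/ last None (fmonom_val k) = Some 0).

Definition phi_letter n (l : letter n) : Ar n :=
  match l with
  | None => Z n
  | Some s => delta s *: Y s - Y 0
  end.
Definition phi_word n (u : word n) : Ar n := \prod_(l <- u) phi_letter l.
Definition phi n (p : Ar n) : Ar n := lin (@phi_word n) p.

Fixpoint Iword_acc n (acc : mu n) (u : word n) : word n :=
  match u with
  | [::] => [::]
  | None :: u' => None :: Iword_acc acc u'
  | Some s :: u' => Some (acc + s) :: Iword_acc (acc + s) u'
  end.
Definition Imap n (p : Ar n) : Ar n := lin (fun u => wrd (Iword_acc 0 u)) p.

Fixpoint Mword n (s : mu n) (u : word n) : word n :=
  match u with
  | [::] => [::]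
  | None :: u' => None :: Mword s u'
  | Some t :: u' => Some (s + t) :: u'
  end.
Definition Mmap n (s : mu n) (p : Ar n) : Ar n := lin (fun u => wrd (Mword s u)) p.

Definition psi n (s : mu n) (p : Ar n) : Ar n := phi (Imap (Mmap s p)).

(* The diamond product, defined recursively on words.  The words are    *)
(* given reversed (head = last letter); k is a fuel, the function is    *)
(* used with k = |v| + |w|, each recursive call decreasing |v| + |w|.   *)
Fixpoint dia n (k : nat) (s : mu n) (rv rw : word n) : Ar n :=
  match rv, rw with
  | [::], _ => wrd (rev rw)
  | _, [::] => psi s (phi (wrd (rev rv)))
  | a :: rv', b :: rw' =>
    match k with
    | 0 => 0
    | k'.+1 =>
      match a, b with
      | None, None =>
          dia k' s rv' rw * X n - dia k' s (Some 0 :: rv') rw' * X n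
      | None, Some t =>
          if t == 0 then
            dia k' s rv' rw * X n + dia k' s rv rw' * Y 0
          else
            dia k' s rv' rw * X n
            + (dia k' s rv' (None :: rw') + dia k' s rv' (Some t :: rw')) * Y t
            - dia k' s (Some 0 :: rv') rw' * Y t
      | Some a', None =>
          if a' == 0 then
            dia k' s rv' rw * Y 0 + dia k' s rv rw' * X n
          else 0 (* v not in A_1: irrelevant *)
      | Some a', Some t =>
          if a' == 0 then
            if t == 0 then
              dia k' s rv' rw * Y 0 - dia k' s (None :: rv') rw' * Y 0
            else
              dia k' s rv' rw * Y 0
              - (dia k' s rv' (None :: rw') + dia k' s rv' (Some t :: rw')) * Y t
              + dia k' s rv rw' * Y t
          else 0 (* v not in A_1: irrelevant *)
      end
    end
  end.

Definition diamond_word n (s : mu n) (v w : word n) : Ar n :=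
  dia (size v + size w) s (rev v) (rev w).

Definition diamond n (s : mu n) (G W : Ar n) : Ar n :=
  lin (fun v => lin (fun w => diamond_word s v w) W) G.

(* Rooted trees.  Trees are represented by planar representatives       *)
(* (Node of the list of children); forests are lists of trees; the      *)
(* empty forest is the unit I.  B_+(f) = Node f.                        *)
Inductive tree := Node of seq tree.
Notation forest := (seq tree).

Fixpoint tsize (t : tree) : nat :=
  let: Node f := t in (foldr (fun t' m => tsize t' + m) 0 f).+1.
Definition fsize (f : forest) : nat := foldr (fun t m => tsize t + m) 0 f.

(* Coproduct, as the list of the terms f' (x) f'' of Delta(f) *)
Definition cop_mul (c1 c2 : seq (forest * forest)) : seq (forest * forest) :=
  [seq (a.1 ++ b.1, a.2 ++ b.2) | a <- c1, b <- c2].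

Fixpoint cop_tree (t : tree) : seq (forest * forest) :=
  let: Node f := t in
  ([:: t], [::]) ::
  [seq (p.1, [:: Node p.2]) | p <-
     (fix copf (g : forest) : seq (forest * forest) :=
        match g with
        | [::] => [:: ([::], [::])]
        | t' :: g' => cop_mul (cop_tree t') (copf g')
        end) f].

Definition cop (f : forest) : seq (forest * forest) :=
  foldr (fun t c => cop_mul (cop_tree t) c) [:: ([::], [::])] f.

(* Elements of H: formal Q-linear combinations of forests *)
Definition Hel := seq (rat * forest).

Definition Hmul (a b : Hel) : Hel :=
  [seq (u.1 * v.1, u.2 ++ v.2) | u <- a, v <- b].

(* Antipode: algebra (anti-)morphism with S(I) = I and
   S(B_+ f) = - sum_{(f)} S(f') B_+(f'')
   (this is m (S (x) id) Delta (B_+ f) = 0, using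
    Delta(B_+ f) = B_+ f (x) I + sum_{(f)} f' (x) B_+(f'')).
   k is a fuel, used with k = fsize f. *)
Fixpoint antip (k : nat) (f : forest) : Hel :=
  match k with
  | 0 => [:: (1, f)]
  | k'.+1 =>
    foldr (fun t acc =>
             Hmul (let: Node g := t in
                   flatten [seq [seq (- c.1, c.2 ++ [:: Node p.2]) | c <- antip k' p.1]
                           | p <- cop g])
                  acc)
          [:: (1, [::])] f
  end.

Definition antipode (f : Hel) : Hel :=
  flatten [seq [seq (c.1 * d.1, d.2) | d <- antip (fsize c.2) c.2] | c <- f].

Definition genpoly n (v : option (mu n)) : Ar n :=
  match v with None => Z n | Some s => Zd s end.

(* letters in the basis {z, z_s^delta}:
   x = z_1^delta, y = z - z_1^delta, y_s = z_s^delta - z_1^delta (s <> 1) *)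
Definition letter_in_gens n (l : letter n) : seq (rat * option (mu n)) :=
  match l with
  | None => [:: (1, Some 0)]
  | Some s => if s == 0 then [:: (1, None); (-1, Some 0)]
              else [:: (1, Some s); (-1, Some 0)]
  end.

Definition Rinv n (w p : Ar n) : Ar n :=
  epsilon (inhabits 0) (fun q => q * w = p).

Definition Rops n (s : mu n) (p : Ar n) : Ar n :=
  Rinv (Z n - Zd s) p * (2%:R *: Z n - Zd s) * (Z n - Zd s).

(* Given the values gv f v = f~(v) on generators, the rule (IV)
   f~(w l) = sum_{(f)} f'~(w) f''~(l), f~(1) = 0 (f <> I), I~ = id;
   words are reversed (head = last letter). *)
Fixpoint tmap_rword n (gv : forest -> option (mu n) -> Ar n) (rw : word n)
  (f : forest) : Ar n :=
  match rw with
  | [::] => if f is [::] then 1 else 0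
  | l :: rw' =>
      \sum_(p <- cop f)
        tmap_rword gv rw' p.1 *
        \sum_(c <- letter_in_gens l) c.1 *: gv p.2 c.2
  end.

(* values f~(v) on generators, rules (I), (II), (III); k is a fuel
   (used with k >= fsize f) *)
Fixpoint genval n (k : nat) (f : forest) (v : option (mu n)) : Ar n :=
  match k with
  | 0 => genpoly v
  | k'.+1 =>
    match f with
    | [::] => genpoly v
    | [:: Node g] =>
        match v with
        | None => 0
        | Some s =>
            if g is [::] then Zd s * (Z n - Zd s)
            else Rops s (genval k' g (Some s))
        end
    | t :: rest =>
        lin (fun u => tmap_rword (@genval n k') (rev u) [:: t])
            (genval k' rest v)
    end
  end.

Definition tmap n (f : forest) (p : Ar n) : Ar n :=
  lin (fun u => tmap_rword (@genval n (fsize f)) (rev u) f) p.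

Definition tmapH n (h : Hel) (p : Ar n) : Ar n :=
  \sum_(c <- h) c.1 *: tmap c.2 p.

(* Main.v *)
Require Import Defs.
From mathcomp Require Import all_boot all_algebra.
From mathcomp Require Import finmap.
From mathcomp.multinomials Require Import monalg.
From Stdlib Require Import ClassicalEpsilon.

(* Write u for any of the generators z, z_s^delta.  For a linear operator D let
   ext D be the operator with ext D (1) = 0 and
     ext D (w u) = ext D (w) u + D (w u) (z - u).
   A polynomial G in z and y acts on A_r by letting the final letters z and y act
   as right multiplication by z and as ext; call these operators E_G.
   - The defining relations of the diamond product are equivalent to
     (v z) <> w = (v <> w) z and (v y) <> (w u) = ((v y) <> w) u + (v <> (w u)) (z - u),
     with (v y) <> 1 = (v <> 1) (z - z_s^delta).  Hence
     E_G (z_s^delta w) = z_s^delta (G <>_s w).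
   - The operators E_G are closed under composition, by a quasi-shuffle rule, and
     the rooted tree map of a nonempty forest f is ext D_f where
     D_{B_+ f} = R_z D_f + f~ and D_{fg} = D_f g~ + f~ D_g - R_z D_f D_g.
   So every element of H, in particular S(f), acts as some E_G with G in A_1^1.
   Uniqueness follows from s = 1 and w = 1, since G <>_1 1 = G. *)

Set Implicit Arguments.
Unset Strict Implicit.
Unset Printing Implicit Defensive.

Import GRing.Theory.
Local Open Scope ring_scope.

(** * Words, linear extension and induction in the free algebra *)

Lemma wrd0 n : wrd [::] = 1 :> Ar n.
Proof. by apply/malgP => k; rewrite mcoeffU1 mcoeff1 eq_sym !fmP fm1. Qed.

Lemma wrdM n (u v : word n) : wrd u * wrd v = wrd (u ++ v).
Proof.
rewrite /wrd malgM_def fgmulUU mulr1; congr << _ *g _ >>.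
by apply/eqP; rewrite fmP fmM.
Qed.

Lemma malg_scaleAr (K : monomType) (R : comNzRingType) (c : R)
  (p q : {malg R[K]}) : c *: (p * q) = p * (c *: q).
Proof.
have mulC : p * malgC c = c *: p.
  rewrite malgM_def fgmulgU malgZ_def /fgscale.
  by apply: eq_bigr => k _; rewrite mulm1 mulrC.
by rewrite -[c *: q]mul_malgC mulrA mulC scalerAl.
Qed.

Lemma scale_mulr n (c : rat) (p q : Ar n) : p * (c *: q) = c *: (p * q).
Proof. by rewrite malg_scaleAr. Qed.

(** Linearity of [lin] compares sums over three different supports, which are first widened to a
    common finite set. *)
Lemma lin_widen n (F : word n -> Ar n) (p : Ar n) (d : {fset {fmonom letter n}}) :
  (msupp p `<=` d)%fset ->
  lin F p = \sum_(k <- d) p@_k *: F (fmonom_val k).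
Proof.
move=> sub; rewrite /lin (big_fset_incl _ sub) // => k _ /mcoeff_outdom ->.
by rewrite scale0r.
Qed.

Lemma lin_is_linear n (F : word n -> Ar n) : linear (lin F).
Proof.
move=> a p q.
pose d := (msupp p `|` msupp q `|` msupp (a *: p + q))%fset.
have sub1 : (msupp p `<=` d)%fset by rewrite /d -fsetUA fsubsetUl.
have sub2 : (msupp q `<=` d)%fset.
  by rewrite /d [(msupp p `|` _)%fset]fsetUC -fsetUA fsubsetUl.
rewrite (lin_widen F sub1) (lin_widen F sub2) (@lin_widen _ F _ d) ?fsubsetUr //.
rewrite scaler_sumr -big_split /=; apply: eq_bigr => k _.
by rewrite mcoeffD mcoeffZ scalerDl scalerA.
Qed.

Lemma lin_wrd n (F : word n -> Ar n) u : lin F (wrd u) = F u.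
Proof. by rewrite /lin msuppU1 big_seq_fset1 mcoeffUU scale1r. Qed.

Lemma Ar_word_ind n (P : Ar n -> Prop) :
  P 0 -> (forall a p q, P p -> P q -> P (a *: p + q)) ->
  (forall u, P (wrd u)) -> forall p, P p.
Proof.
move=> P0 PD Pw p; rewrite (monalgE p).
elim: (X in \sum_(i <- X) _) => [|k s IH]; first by rewrite big_nil.
rewrite big_cons; have -> : << p@_k *g k >> = p@_k *: wrd (fmonom_val k).
  by rewrite /wrd fmK -mul_malgC malgM_def fgmulUU mulr1 mul1m.
exact: PD.
Qed.

Lemma X_gen n : X n = Zd 0.
Proof. by rewrite /Zd /delta eqxx scale0r addr0. Qed.

Lemma letter_gens n (l : letter n) :
  wrd [:: l] = \sum_(c <- letter_in_gens l) c.1 *: genpoly c.2.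
Proof.
case: l => [s|] /=; last by rewrite big_seq1 scale1r /= -X_gen.
case: ifP => [/eqP->|s0]; rewrite big_cons big_seq1 /= scale1r scaleN1r -X_gen.
  by rewrite /Z addrC addKr.
by rewrite /Zd /delta s0 scale1r addrC addKr.
Qed.

(** Every letter is a rational combination of the generators z and z_s^delta, so a linear property
    stable under right multiplication by generators is stable under letters. *)
Lemma Ar_gen_ind n (P : Ar n -> Prop) :
  (forall a p q, P p -> P q -> P (a *: p + q)) -> P 1 ->
  (forall p v, P p -> P (p * genpoly v)) -> forall p, P p.
Proof.
move=> PD P1 PM; have P0 : P 0 by rewrite -(addNr 1) -scaleN1r; apply: PD.
apply: Ar_word_ind; [exact: P0|exact: PD|].
apply: last_ind => [|u l IH]; first by rewrite wrd0.
rewrite -cats1 -wrdM letter_gens mulr_sumr.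
elim: (letter_in_gens l) => [|c s IHs]; first by rewrite big_nil.
rewrite big_cons (scale_mulr c.1 (wrd u)).
by apply: PD; [exact: PM|exact: IHs].
Qed.

(* Proves identities between noncommutative polynomials by expanding and then
   cancelling monomials pairwise. It is only run in an abstract [lalgType]: in
   [Ar n] the rewriting patterns get unified by unfolding the operations of
   the monoid algebra. Hence the local facts [key] below. *)
Ltac nc_expand :=
  rewrite ?(mulrDl, mulrDr, mulNr, mulrN, opprD, opprK, scalerDr, scalerN,
            mul0r, mulr0, mul1r, mulr1, scale1r, scaleN1r, scaler0, oppr0,
            scale0r);
  rewrite -?scalerAl ?scalerA ?mulrA ?addr0 ?add0r ?addrA ?opprK.

Ltac nc_ring :=
  apply/eqP; rewrite -subr_eq0; apply/eqP; nc_expand;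
  rewrite -[LHS]add0r ?addrA;
  repeat match goal with
  | |- 0 = 0 => reflexivity
  | |- _ + - ?t = 0 => rewrite ?(addrAC _ t) ?subrK ?addrK
  | |- _ + ?t = 0 => rewrite ?(addrAC _ (- t)) ?addrK ?subrK
  end.

(** * Linear maps, and identities stable under linear combinations *)

Section LinearMaps.
Context (A : lalgType rat) (D : A -> A) (lD : linear D).

Lemma linmapD p q : D (p + q) = D p + D q.
Proof. by rewrite -{1}(scale1r p) lD scale1r. Qed.

Lemma linmap0 : D 0 = 0.
Proof. by apply: (addrI (D 0)); rewrite -linmapD !addr0. Qed.

Lemma linmapZ a p : D (a *: p) = a *: D p.
Proof. by rewrite -[a *: p]addr0 lD linmap0 addr0. Qed.

Lemma linmapN p : D (- p) = - D p.
Proof. by rewrite -scaleN1r linmapZ scaleN1r. Qed.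

Lemma linmap_sum I (r : seq I) (F : I -> A) :
  D (\sum_(i <- r) F i) = \sum_(i <- r) D (F i).
Proof. by apply: (big_morph D linmapD linmap0). Qed.
End LinearMaps.

Lemma eq_linear n (F G : Ar n -> Ar n) :
  linear F -> linear G -> (forall u, F (wrd u) = G (wrd u)) -> F =1 G.
Proof.
move=> lF lG e; elim/Ar_word_ind => [|a p q IHp IHq|//].
  by apply: etrans (linmap0 lF) (esym (linmap0 lG)).
by rewrite lF lG IHp IHq.
Qed.

Lemma comb_mull (A : lalgType rat) (a : rat) (p q t : A) :
  (a *: p + q) * t = a *: (p * t) + q * t.
Proof. by rewrite mulrDl scalerAl. Qed.

Lemma comb_mulr n (a : rat) (p q t : Ar n) :
  t * (a *: p + q) = a *: (t * p) + t * q.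
Proof. by rewrite (mulrDr t (a *: p)) (scale_mulr a t). Qed.

Lemma leibniz_comb (A : lalgType rat) (E D : A -> A) (t t' : A) :
  linear E -> linear D -> forall a p q,
  E (p * t) = E p * t + D (p * t) * t' ->
  E (q * t) = E q * t + D (q * t) * t' ->
  E ((a *: p + q) * t) = E (a *: p + q) * t + D ((a *: p + q) * t) * t'.
Proof.
move=> lE lD a p q Ep Eq.
by rewrite comb_mull !lE lD Ep Eq; nc_ring.
Qed.

Lemma intertwine_comb (A : lalgType rat) (B : A -> A) (y t : A) :
  linear B -> forall a p q,
  B (p * y) = B p * t -> B (q * y) = B q * t ->
  B ((a *: p + q) * y) = B (a *: p + q) * t.
Proof. by move=> lB a p q Hp Hq; rewrite comb_mull !lB Hp Hq comb_mull. Qed.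

Lemma intertwine0 (A : lalgType rat) (B : A -> A) (y t : A) :
  linear B -> B (0 * y) = B 0 * t.
Proof. by move=> lB; rewrite mul0r (linmap0 lB) mul0r. Qed.

Lemma bilinear_leibniz_comb (A : lalgType rat) (B : A -> A -> A) (y t t' : A) :
  (forall w, linear (B^~ w)) -> forall a p q w,
  B (p * y) (w * t) = B (p * y) w * t + B p (w * t) * t' ->
  B (q * y) (w * t) = B (q * y) w * t + B q (w * t) * t' ->
  B ((a *: p + q) * y) (w * t) =
  B ((a *: p + q) * y) w * t + B (a *: p + q) (w * t) * t'.
Proof.
by move=> lB a p q w Hp Hq; rewrite comb_mull !lB Hp Hq; nc_ring.
Qed.

(** The children of a node sit in a list, so trees and forests need a joint induction. *)
Lemma forest_ind (P : tree -> Prop) (Q : forest -> Prop) :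
  Q [::] -> (forall t f, P t -> Q f -> Q (t :: f)) ->
  (forall f, Q f -> P (Node f)) -> forall f, Q f.
Proof.
move=> Q0 QS PN.
have PT : forall t, P t.
  fix IH 1 => -[f]; apply: PN; elim: f => [//|t f IHf].
  by apply: QS => //; apply: IH.
by elim=> // t f; apply: QS.
Qed.

Lemma cop_tree_node f :
  cop_tree (Node f) =
  ([:: Node f], [::]) :: [seq (p.1, [:: Node p.2]) | p <- cop f].
Proof. by rewrite /=; congr (_ :: map _ _); elim: f => //= t f ->. Qed.

(** * Operators attached to polynomials in z and y *)

Section Representable.
(** [A] is an abstract algebra with generators [g v], among them z. [ext] is known only through
    linearity, its value at 1 and its rule on [p * g v], which determine it. *)
Context (A : lalgType rat) (z : A) (V : Type) (g : V -> A) (v0 : V).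
Hypothesis scale_mulr : forall (c : rat) (p q : A), p * (c *: q) = c *: (p * q).
Hypothesis g_v0 : g v0 = z.
Hypothesis gen_ind : forall P : A -> Prop,
  (forall a p q, P p -> P q -> P (a *: p + q)) -> P 1 ->
  (forall p v, P p -> P (p * g v)) -> forall p, P p.
Context (ext : (A -> A) -> A -> A).
Hypothesis ext_linear : forall D, linear (ext D).
Hypothesis ext1 : forall D, ext D 1 = 0.
Hypothesis ext_gen : forall D p v, linear D ->
  ext D (p * g v) = ext D p * g v + D (p * g v) * (z - g v).

Lemma ext_unique (L D : A -> A) : linear L -> linear D -> L 1 = 0 ->
  (forall p v, L (p * g v) = L p * g v + D (p * g v) * (z - g v)) ->
  L =1 ext D.
Proof.
move=> lL lD L1 LM; have lE := ext_linear D.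
apply: gen_ind => [a p q IHp IHq||p v IH]; first by rewrite lL lE IHp IHq.
  by rewrite L1 ext1.
by rewrite LM IH ext_gen.
Qed.

Lemma ext_mulz (D : A -> A) p : linear D -> ext D (p * z) = ext D p * z.
Proof. by move=> lD; rewrite -g_v0 ext_gen // -g_v0 subrr mulr0 addr0. Qed.

Lemma ext_gen1 (D : A -> A) v : linear D -> ext D (g v) = D (g v) * (z - g v).
Proof. by move=> lD; rewrite -{1}[g v]mul1r ext_gen // ext1 mul0r add0r mul1r. Qed.

(* [rep D] says that [D] is the operator attached to a polynomial in [z] and
   [y]: [D |-> D * z] appends a letter [z], and [ext] appends a letter [y]. *)
Inductive rep : (A -> A) -> Prop :=
| rep_id : rep id
| rep_comb a D1 D2 : rep D1 -> rep D2 -> rep (fun p => a *: D1 p + D2 p)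
| rep_mulz D : rep D -> rep (fun p => D p * z)
| rep_ext D : rep D -> rep (ext D)
| rep_eq D1 D2 : D1 =1 D2 -> rep D1 -> rep D2.

Lemma rep_linear (D : A -> A) : rep D -> linear D.
Proof.
elim=> {D} [|a D1 D2 _ l1 _ l2|D _ lD|D _ _|D1 D2 eqD _ l1] b p q //.
- by rewrite l1 l2 !scalerDr !scalerA mulrC addrACA.
- by rewrite lD mulrDl scalerAl.
- exact: ext_linear.
- by rewrite -!eqD l1.
Qed.

(** For [ext] this is the rule on the generator z, whose correction has the factor z - z = 0. *)
Lemma rep_commz (D : A -> A) p : rep D -> D (p * z) = D p * z.
Proof.
move=> rD; elim: rD p => {D} [|a D1 D2 _ H1 _ H2|D _ HD|D rD _|D1 D2 eqD _ H1] p //.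
- by rewrite H1 H2 mulrDl scalerAl.
- by rewrite HD.
- by rewrite ext_mulz //; apply: rep_linear.
- by rewrite -!eqD H1.
Qed.

Lemma rep0 : rep (fun=> 0).
Proof.
by apply: rep_eq (rep_comb (-1) rep_id rep_id) => p; rewrite scaleN1r addNr.
Qed.

Lemma rep_add (D1 D2 : A -> A) :
  rep D1 -> rep D2 -> rep (fun p => D1 p + D2 p).
Proof. by move=> r1 r2; apply: rep_eq (rep_comb 1 r1 r2) => p; rewrite scale1r. Qed.

Lemma rep_sub (D1 D2 : A -> A) :
  rep D1 -> rep D2 -> rep (fun p => D1 p - D2 p).
Proof.
move=> r1 r2; apply: rep_eq (rep_comb (-1) r2 r1) => p.
by rewrite scaleN1r addrC.
Qed.

(* The quasi-shuffle rule [vy * wy = (v * wy) y + (vy * w) y - (v * w) z y],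
   with the last [y] removed. *)
Definition qshuffle (D1 T1 D2 T2 : A -> A) (p : A) : A :=
  D1 (T2 p) + T1 (D2 p) - D1 (D2 p) * z.

(** By [ext_unique] it suffices to expand the left side at p u. With W = D2(p u), the factor of z -
    u is D1(ext D2 p u) + ext D1 W - D1(W u). In [qshuffle] at p u the additional D1(W z) cancels
    against D1(W) z by [rep_commz]. *)
Lemma ext_comp (D1 D2 : A -> A) : rep D1 -> rep D2 ->
  ext D1 \o ext D2 =1 ext (qshuffle D1 (ext D1) D2 (ext D2)).
Proof.
move=> r1 r2; have l1 := rep_linear r1; have l2 := rep_linear r2.
have L1 := ext_linear D1; have L2 := ext_linear D2.
apply: ext_unique => [b p q /=|b p q||p v]; first by rewrite L2 L1.
- by rewrite /qshuffle !(l1, l2, L1, L2); nc_ring.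
- by rewrite /= ext1 (linmap0 L1).
rewrite /= (ext_gen p v l2) (linmapD L1) (ext_gen (ext D2 p) v l1).
set W := D2 (p * g v).
rewrite [W * (_ - _)]mulrBr (linmapD L1) (linmapN L1) (ext_mulz _ l1) (ext_gen W v l1).
rewrite /qshuffle (ext_gen p v l2) -/W [W * (_ - _)]mulrBr !(linmapD l1, linmapN l1).
by rewrite (rep_commz _ r1); nc_ring.
Qed.

(** Induction on [D1], and on [D2] inside the case of [ext D1]. For two [ext], [ext_comp] leaves
    [D1 \o ext D2] and [D1 \o D2], covered by the outer induction, and [ext D1 \o D2], covered by
    the inner one. *)
Lemma rep_comp (D1 D2 : A -> A) : rep D1 -> rep D2 -> rep (D1 \o D2).
Proof.
move=> r1; elim: r1 D2 => {D1} [|a D1 D1' _ H1 _ H2|D1 _ H|D1 r1 H|D1 D1' eqD _ H] D2 r2 //.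
- exact: rep_comb (H1 _ r2) (H2 _ r2).
- exact: rep_mulz (H _ r2).
- have L1 := ext_linear D1; have l1 := rep_linear r1.
  elim: r2 => {D2} [|a D2 D2' _ H1 _ H2|D2 _ H2|D2 r2 H2|D2 D2' eqD _ H2].
  + exact: rep_ext.
  + by apply: rep_eq (rep_comb a H1 H2) => p /=; rewrite L1.
  + by apply: rep_eq (rep_mulz H2) => p /=; rewrite ext_mulz.
  + apply: rep_eq (fun p => esym (ext_comp r1 r2 p)) _; apply: rep_ext.
    apply: rep_sub (rep_mulz (H _ r2)).
    exact: rep_add (H _ (rep_ext r2)) H2.
  + by apply: rep_eq H2 => p /=; rewrite eqD.
- by apply: rep_eq (H _ r2) => p /=; rewrite eqD.
Qed.

(** [ext] takes a function as argument, so passing to a pointwise equal one is justified by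
    uniqueness. *)
Lemma ext_eq (D1 D2 : A -> A) : rep D1 -> D1 =1 D2 -> ext D1 =1 ext D2.
Proof.
move=> r1 eqD; have r2 := rep_eq eqD r1.
apply: ext_unique => [|||p v].
- exact: ext_linear.
- exact: rep_linear.
- exact: ext1.
by rewrite ext_gen ?eqD //; apply: rep_linear.
Qed.

(** * Rooted tree maps as operators *)

Definition mul_ops (a b : (A -> A) * (A -> A)) : (A -> A) * (A -> A) :=
  (a.1 \o b.1, qshuffle a.2 a.1 b.2 b.1).

(* The first component of [forest_ops f] is the rooted tree map of [f]; when
   [f] is nonempty it is [ext] of the second component, which is [0] for the
   empty forest. *)
Fixpoint tree_ops (t : tree) : (A -> A) * (A -> A) :=
  let: Node f := t in
  let TD := foldr (fun t' => mul_ops (tree_ops t')) (id, fun=> 0) f in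
  let D := fun p => TD.2 p * z + TD.1 p in
  (ext D, D).

Definition forest_ops (f : forest) :=
  foldr (fun t => mul_ops (tree_ops t)) (id, fun=> 0) f.

Definition Tmap f := (forest_ops f).1.
Definition Dmap f := (forest_ops f).2.
Definition Dnode f p := Dmap f p * z + Tmap f p.

Lemma tree_ops_node f : tree_ops (Node f) = (ext (Dnode f), Dnode f).
Proof. by []. Qed.

Lemma Tmap_cons t f : Tmap (t :: f) = (tree_ops t).1 \o Tmap f.
Proof. by []. Qed.

Lemma Dmap_cons t f :
  Dmap (t :: f) = qshuffle (tree_ops t).2 (tree_ops t).1 (Dmap f) (Tmap f).
Proof. by []. Qed.

Lemma rep_forest_ops f : rep (Tmap f) /\ rep (Dmap f).
Proof.
move: f; apply: (@forest_ind (fun t => rep (tree_ops t).1 /\ rep (tree_ops t).2)).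
- by split; [exact: rep_id|exact: rep0].
- move=> t f [rT rD] [rT' rD']; split; first exact: rep_comp.
  apply: rep_sub (rep_mulz (rep_comp rD rD')).
  exact: rep_add (rep_comp rD rT') (rep_comp rT rD').
- move=> f [rT rD]; rewrite tree_ops_node.
  have rN : rep (Dnode f) by apply: rep_add rT; apply: rep_mulz.
  by split=> //; apply: rep_ext.
Qed.

Lemma rep_Tmap f : rep (Tmap f). Proof. by case: (rep_forest_ops f). Qed.
Lemma rep_Dmap f : rep (Dmap f). Proof. by case: (rep_forest_ops f). Qed.

Lemma rep_Dnode f : rep (Dnode f).
Proof. by apply: rep_add (rep_Tmap f); apply: rep_mulz (rep_Dmap f). Qed.

Lemma Tmap_node f : Tmap [:: Node f] = ext (Dnode f).
Proof. by []. Qed.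

Lemma Dmap_node f : Dmap [:: Node f] =1 Dnode f.
Proof.
move=> p; rewrite Dmap_cons tree_ops_node /qshuffle [in LHS]/fst [in LHS]/snd.
rewrite (linmap0 (rep_linear (rep_Dnode f))) (linmap0 (ext_linear _)).
by rewrite mul0r subr0 addr0.
Qed.

(** The forest is nonempty, since the empty one acts as [id], which does not kill 1. [ext_comp]
    composes the first tree with the rest, and [ext_eq] matches [ext (Dmap _)] with [Tmap] inside
    [qshuffle]. *)
Lemma Tmap_ext t f : Tmap (t :: f) =1 ext (Dmap (t :: f)).
Proof.
elim: f t => [|t' f IH] [f0].
  by move=> p; rewrite (ext_eq (rep_Dmap _) (Dmap_node f0)) Tmap_node.
move=> p; rewrite Tmap_cons tree_ops_node [(_ \o _) p]/= (IH t').
have := ext_comp (rep_Dnode f0) (rep_Dmap (t' :: f)) p.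
rewrite [(_ \o _) p]/= => ->; apply: ext_eq => [|q]; last first.
  by rewrite [in RHS]Dmap_cons tree_ops_node /qshuffle (IH t').
apply: rep_sub; last exact: rep_mulz (rep_comp (rep_Dnode _) (rep_Dmap _)).
apply: rep_add; first exact: rep_comp (rep_Dnode _) (rep_ext (rep_Dmap _)).
exact: rep_comp (rep_ext (rep_Dnode _)) (rep_Dmap _).
Qed.

Lemma Tmap_cat f1 f2 : Tmap (f1 ++ f2) =1 Tmap f1 \o Tmap f2.
Proof.
by elim: f1 => // t f1 IH p; rewrite /= !Tmap_cons /= IH.
Qed.

(** This is the associativity of [qshuffle]; factors z are moved out of the operators by
    [rep_commz]. *)
Lemma Dmap_cat f1 f2 :
  Dmap (f1 ++ f2) =1 qshuffle (Dmap f1) (Tmap f1) (Dmap f2) (Tmap f2).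
Proof.
elim: f1 => [|[f] f1 IH] p.
  by rewrite /qshuffle /= /Dmap /Tmap /= mul0r subr0 add0r.
have rD := rep_Dnode f; have rT := rep_ext rD.
have [lD lT] := (rep_linear rD, rep_linear rT).
rewrite cat_cons !Dmap_cons Tmap_cons tree_ops_node {1}/qshuffle /fst /snd.
rewrite IH Tmap_cat /= /qshuffle !(linmapD lD, linmapN lD, linmapD lT, linmapN lT).
rewrite !(rep_commz _ rD) !(rep_commz _ rT).
by nc_ring.
Qed.

(** The first summand comes from B_+(f) tensor the empty forest, the sum from the terms f' tensor
    B_+(f''). [Dnode f] inherits a product rule from the two hypotheses, and induction on q through
    the generators carries it over to [ext]. *)
Lemma Tmap_cop_node f :
  (forall p q, Tmap f (p * q) = \sum_(c <- cop f) Tmap c.1 p * Tmap c.2 q) ->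
  (forall p q, Dmap f (p * q) = \sum_(c <- cop f) Tmap c.1 p * Dmap c.2 q) ->
  forall p q, ext (Dnode f) (p * q) = ext (Dnode f) p * q +
    \sum_(c <- cop f) Tmap c.1 p * ext (Dnode c.2) q.
Proof.
move=> HT HD p; have lN g := rep_linear (rep_Dnode g).
have HN q : Dnode f (p * q) = \sum_(c <- cop f) Tmap c.1 p * Dnode c.2 q.
  rewrite /Dnode HT HD mulr_suml -big_split /=.
  by apply: eq_bigr => c _; rewrite mulrDr !mulrA.
apply: gen_ind => [a q q' IH IH'||q v IH].
- rewrite mulrDr scale_mulr ext_linear IH IH' mulrDr scale_mulr scalerDr addrACA.
  rewrite scaler_sumr -big_split /=; congr (_ + _); apply: eq_bigr => c _.
  by rewrite ext_linear mulrDr scale_mulr.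
- by rewrite big1 ?addr0 ?mulr1 // => c _; rewrite ext1 mulr0.
rewrite mulrA ext_gen // IH -[p * q * _]mulrA HN mulrDl -addrA mulrA.
congr (_ + _); rewrite !mulr_suml -big_split /=; apply: eq_bigr => c _.
by rewrite ext_gen //; nc_ring.
Qed.

(** Rule (IV) for arbitrary second factors. The rule for [Dmap] is proved along with it, because the
    case of B_+ goes through [Dnode]. *)
Lemma Tmap_cop f :
  (forall p q, Tmap f (p * q) = \sum_(c <- cop f) Tmap c.1 p * Tmap c.2 q) /\
  (forall p q, Dmap f (p * q) = \sum_(c <- cop f) Tmap c.1 p * Dmap c.2 q).
Proof.
move: f; apply: (@forest_ind (fun t =>
  (forall p q, Tmap [:: t] (p * q) =
               \sum_(c <- cop_tree t) Tmap c.1 p * Tmap c.2 q) /\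
  (forall p q, Dmap [:: t] (p * q) =
               \sum_(c <- cop_tree t) Tmap c.1 p * Dmap c.2 q))).
- split=> p q; rewrite /= big_seq1 //=.
  by rewrite /Dmap /= mulr0.
- move=> t f [Tt Dt] [Tf Df].
  have [lT lD] := (rep_linear (rep_Tmap [:: t]), rep_linear (rep_Dmap [:: t])).
  split=> p q.
    rewrite (Tmap_cat [:: t] f) /= Tf (linmap_sum lT) /cop_mul big_allpairs_dep.
    rewrite exchange_big /=; apply: eq_bigr => b _; rewrite Tt.
    by apply: eq_bigr => a _ /=; rewrite !Tmap_cat.
  rewrite (Dmap_cat [:: t] f) /qshuffle Tf Df.
  rewrite (linmap_sum lT) !(linmap_sum lD) mulr_suml -big_split -sumrB /=.
  rewrite /cop_mul big_allpairs_dep exchange_big /=; apply: eq_bigr => b _.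
  rewrite Tt !Dt mulr_suml -big_split -sumrB /=.
  apply: eq_bigr => a _; rewrite Tmap_cat Dmap_cat /qshuffle /=.
  by nc_ring.
- move=> f [HT HD]; rewrite cop_tree_node; split=> p q; rewrite big_cons big_map /=.
    by rewrite Tmap_node Tmap_cop_node.
  (* [Dmap [::]] is 0, so the term of B_+(f) tensor the empty forest disappears. *)
  rewrite Dmap_node /Dnode HT HD {2}/Dmap /= mulr0 add0r mulr_suml -big_split /=.
  by apply: eq_bigr => c _; rewrite Dmap_node /Dnode mulrDr mulrA.
Qed.

Lemma Tmap_linear f : linear (Tmap f).
Proof. exact: rep_linear (rep_Tmap f). Qed.

Lemma Tmap1 t f : Tmap (t :: f) 1 = 0.
Proof. by rewrite Tmap_ext ext1. Qed.

(** This exhibits the final factor z - z_s^delta that rule (II) removes. *)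
Lemma Tmap_gen t f v :
  Tmap (t :: f) (g v) = Dmap (t :: f) (g v) * (z - g v).
Proof. by rewrite Tmap_ext ext_gen1 //; apply: rep_linear (rep_Dmap _). Qed.

Lemma Tmap_z t f : Tmap (t :: f) z = 0.
Proof. by rewrite -[in LHS]g_v0 Tmap_gen g_v0 subrr mulr0. Qed.

Lemma Tmap_leaf v : Tmap [:: Node [::]] (g v) = g v * (z - g v).
Proof. by rewrite Tmap_gen Dmap_node /Dnode /Dmap /= mul0r add0r. Qed.

(** With u = g v, rule (II) amounts to D_f(u) z + D_f(u) (z - u) = D_f(u) (2z - u). *)
Lemma Tmap_node_gen t f v :
  Tmap [:: Node (t :: f)] (g v) =
  Dmap (t :: f) (g v) * (2%:R *: z - g v) * (z - g v).
Proof.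
rewrite Tmap_gen Dmap_node /Dnode Tmap_gen -mulrDr addrA.
by rewrite scaler_nat mulr2n.
Qed.

Lemma Tmap_rep_ext t f : exists2 D, rep D & Tmap (t :: f) =1 ext D.
Proof. by exists (Dmap (t :: f)); [exact: rep_Dmap|exact: Tmap_ext]. Qed.

End Representable.

(** * The operators on A_r *)

(** The correction D(w u) (z - u) is not linear in u, so for a letter it is expanded over the
    generators; ext D(w) u is linear in u and keeps the letter. *)
Fixpoint ext_rword n (D : Ar n -> Ar n) (rw : word n) : Ar n :=
  match rw with
  | [::] => 0
  | l :: rw' =>
      ext_rword D rw' * wrd [:: l] +
      \sum_(c <- letter_in_gens l)
        c.1 *: (D (wrd (rev rw') * genpoly c.2) * (Z n - genpoly c.2))
  end.

Definition ext n (D : Ar n -> Ar n) : Ar n -> Ar n :=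
  lin (fun u => ext_rword D (rev u)).

Lemma ext_linear n (D : Ar n -> Ar n) : linear (ext D).
Proof. exact: lin_is_linear. Qed.

Lemma ext1 n (D : Ar n -> Ar n) : ext D 1 = 0.
Proof. by rewrite -wrd0 /ext lin_wrd. Qed.

Lemma ext_letter n (D : Ar n -> Ar n) u l :
  ext D (wrd u * wrd [:: l]) = ext D (wrd u) * wrd [:: l] +
    \sum_(c <- letter_in_gens l)
      c.1 *: (D (wrd u * genpoly c.2) * (Z n - genpoly c.2)).
Proof. by rewrite wrdM /ext !lin_wrd rev_cat /= revK. Qed.

Lemma Zd_neq0 n (s : mu n) : s != 0 -> Zd s = X n + Y s.
Proof. by move=> s0; rewrite /Zd /delta (negbTE s0) scale1r. Qed.

(** The definition covers letters only. For x + y and x + y_s, the correction of x cancels the one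
    that z_1^delta = x contributes with coefficient -1 to the other letter. *)
Lemma ext_gen n (D : Ar n -> Ar n) p v : linear D ->
  ext D (p * genpoly v) =
  ext D p * genpoly v + D (p * genpoly v) * (Z n - genpoly v).
Proof.
move=> lD; have lE := ext_linear D.
elim/Ar_word_ind: p => [|a p q IHp IHq|u].
- by rewrite mul0r (linmap0 lE) (linmap0 lD) !mul0r addr0.
- exact: (@leibniz_comb (Ar n) (ext D) D (genpoly v) (Z n - genpoly v)
            lE lD a p q IHp IHq).
have EX : ext D (wrd u * X n) = ext D (wrd u) * X n
          + D (wrd u * X n) * (Z n - X n).
  by rewrite ext_letter /= big_seq1 scale1r /= -X_gen.
have EY s : ext D (wrd u * Y s) = ext D (wrd u) * Y s +
    \sum_(c <- letter_in_gens (Some s))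
      c.1 *: (D (wrd u * genpoly c.2) * (Z n - genpoly c.2)).
  exact: ext_letter.
have EXY s : ext D (wrd u * (X n + Y s)) =
             ext D (wrd u * X n) + ext D (wrd u * Y s).
  by rewrite (mulrDr (wrd u) (X n) (Y s)); exact: (linmapD lE).
have EXYE s := etrans (EXY s) (f_equal2 +%R EX (EY s)).
case: v => [s|]; last first.
  apply: etrans (EXYE 0) _; rewrite [letter_in_gens _]/= big_cons big_seq1 /=.
  rewrite -X_gen (subrr (Z n)).
  have key (A : lalgType rat) (e d d' x y t : A) :
    e * x + d * t + (e * y + (1 *: (d' * 0) + -1 *: (d * t))) =
    e * (x + y) + d' * 0 by nc_ring.
  exact: key.
have [->|s0] := eqVneq s 0; first by rewrite [genpoly _]/= -X_gen; exact: EX.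
have := EXYE s; rewrite [letter_in_gens _]/= (negbTE s0) big_cons big_seq1 /=.
rewrite -X_gen (Zd_neq0 s0) => e; apply: etrans e _.
have key (A : lalgType rat) (e d d' x y t t' : A) :
  e * x + d * t + (e * y + (1 *: (d' * t') + -1 *: (d * t))) =
  e * (x + y) + d' * t' by nc_ring.
exact: key.
Qed.

(** * Coefficients, and cancellation of factors *)

Lemma eq_functional n (f g : Ar n -> rat) :
  scalar f -> scalar g -> (forall u, f (wrd u) = g (wrd u)) -> f =1 g.
Proof.
move=> lf lg e; have nul h : scalar h -> h (0 : Ar n) = 0.
  by move=> lh; have := lh (-1) 0 0; rewrite scaler0 addr0 mulN1r addNr.
elim/Ar_word_ind => [|a p q IHp IHq|//]; first by rewrite !nul.
by rewrite lf lg IHp IHq.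
Qed.

Lemma mcoeff_scalar n (k : {fmonom letter n}) : scalar (fun p : Ar n => p@_k).
Proof. by move=> a p q; rewrite mcoeffD mcoeffZ. Qed.

(** z - z_s^delta is y - delta(s) y_s, and the second term never contributes a word ending in y:
    either delta(s) = 0 or y_s differs from y. *)
Lemma mcoeff_mulr_gap n (s : mu n) (p : Ar n) u :
  (p * (Z n - Zd s))@_(FMonom (rcons u (Some 0))) = p@_(FMonom u).
Proof.
have -> : Z n - Zd s = Y 0 - delta s *: Y s.
  have key (A : lalgType rat) (x y y' : A) : x + y - (x + y') = y - y' by nc_ring.
  exact: key.
move: p; apply: eq_functional => [a p q||u'].
- by rewrite (comb_mull a p q); apply: mcoeff_scalar.
- exact: mcoeff_scalar.
have -> : wrd u' * (Y 0 - delta s *: Y s) =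
          wrd (rcons u' (Some 0)) - delta s *: wrd (rcons u' (Some s)).
  rewrite (mulrBr (wrd u') (Y 0)) (scale_mulr (delta s) (wrd u')).
  by rewrite -2!cats1 -2!wrdM.
rewrite mcoeffB mcoeffZ 3!mcoeffU1 3!fmP [fmonom_val _]/=.
rewrite !eqseq_rcons eqxx andbT /delta.
case: (eqVneq s 0) => [_|s0]; first by rewrite mul0r subr0.
by rewrite (_ : (Some s == Some 0) = false) ?andbF ?mulr0 ?subr0 //; apply: negbTE.
Qed.

Lemma mulr_gap_inj n (s : mu n) (p q : Ar n) :
  p * (Z n - Zd s) = q * (Z n - Zd s) -> p = q.
Proof.
by move=> e; apply/malgP => -[u]; rewrite -(mcoeff_mulr_gap s) e mcoeff_mulr_gap.
Qed.

(** [Rinv] is a choice; here a preimage exists, and it is unique by cancellation. *)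
Lemma Rinv_gap n (s : mu n) (p : Ar n) : Rinv (Z n - Zd s) (p * (Z n - Zd s)) = p.
Proof.
apply: (@mulr_gap_inj n s); rewrite /Rinv.
apply: (epsilon_spec (inhabits 0) (fun q => q * (Z n - Zd s) = p * (Z n - Zd s))).
by exists p.
Qed.

Lemma mcoeff_mulXl n (p : Ar n) u : (X n * p)@_(FMonom (None :: u)) = p@_(FMonom u).
Proof.
move: p; apply: eq_functional => [a p q||u'].
- by rewrite (comb_mulr a p q); apply: mcoeff_scalar.
- exact: mcoeff_scalar.
by rewrite wrdM 2!mcoeffU1 2!fmP [fmonom_val _]/= eqseq_cons eqxx.
Qed.

Lemma mulX_inj n (p q : Ar n) : X n * p = X n * q -> p = q.
Proof.
by move=> e; apply/malgP => -[u]; rewrite -mcoeff_mulXl e mcoeff_mulXl.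
Qed.

(** * Specialisation to A_r *)

Definition Top n : forest -> Ar n -> Ar n := Tmap (Z n) (@ext n).
Definition Dop n : forest -> Ar n -> Ar n := Dmap (Z n) (@ext n).
Definition repAr n : (Ar n -> Ar n) -> Prop := rep (Z n) (@ext n).

Section Instances.
Context (n : nat).
Let gZ : genpoly None = Z n := erefl.
Let gi := @Ar_gen_ind n.
Let el := @ext_linear n.
Let e1 := @ext1 n.
Let eg := @ext_gen n.

Lemma Top_linear f : linear (@Top n f).
Proof. exact: (Tmap_linear gZ gi el e1 eg). Qed.

Lemma Top1 t f : @Top n (t :: f) 1 = 0.
Proof. exact: (Tmap1 gZ gi el e1 eg). Qed.

Lemma Top_cop f p q :
  @Top n f (p * q) = \sum_(c <- cop f) Top c.1 p * Top c.2 q.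
Proof. exact: (proj1 (Tmap_cop (@scale_mulr n) gZ gi el e1 eg f)). Qed.

Lemma Top_gen t f v :
  @Top n (t :: f) (genpoly v) = Dop (t :: f) (genpoly v) * (Z n - genpoly v).
Proof. exact: (Tmap_gen gZ gi el e1 eg). Qed.

Lemma Top_Z t f : @Top n (t :: f) (Z n) = 0.
Proof. exact: (Tmap_z gZ gi el e1 eg). Qed.

Lemma Top_leaf v :
  @Top n [:: Node [::]] (genpoly v) = genpoly v * (Z n - genpoly v).
Proof. exact: (Tmap_leaf gZ gi el e1 eg). Qed.

Lemma Top_node_gen t f v :
  @Top n [:: Node (t :: f)] (genpoly v) =
  Dop (t :: f) (genpoly v) * (2%:R *: Z n - genpoly v) * (Z n - genpoly v).
Proof. exact: (Tmap_node_gen gZ gi el e1 eg). Qed.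

Lemma Top_rep_ext t f : exists2 D, @repAr n D & Top (t :: f) =1 ext D.
Proof. exact: (Tmap_rep_ext gZ gi el e1 eg). Qed.

End Instances.

(** * Agreement of [tmap] with the operators *)

Lemma fsize_cons t f : fsize (t :: f) = (Defs.tsize t + fsize f)%N.
Proof. by []. Qed.

Lemma tsize_node f : Defs.tsize (Node f) = (fsize f).+1.
Proof. by []. Qed.

Lemma fsize1 t : fsize [:: t] = Defs.tsize t.
Proof. by rewrite fsize_cons addn0. Qed.

(** The grading of the coproduct by the number of vertices bounds the fuel needed on both factors.
    [tree] carries no decidable equality, so [all] stands in for membership. *)
Lemma cop_size f : all (fun c => fsize c.1 + fsize c.2 == fsize f)%N (cop f).
Proof.
have fsize_cat g h : fsize (g ++ h) = (fsize g + fsize h)%N.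
  by elim: g => // t g IH; rewrite cat_cons !fsize_cons IH addnA.
move: f; apply: (@forest_ind (fun t =>
  all (fun c => fsize c.1 + fsize c.2 == Defs.tsize t)%N (cop_tree t))) => //.
- move=> t f Ht Hf; rewrite fsize_cons [cop _]/= /cop_mul.
  elim: (cop_tree t) Ht => //= a s IH /andP [/eqP Ha Hs].
  rewrite all_cat IH // andbT all_map; apply: sub_all Hf => b /= /eqP Hb.
  by rewrite !fsize_cat -Ha -Hb addnACA.
- move=> f Hf; rewrite cop_tree_node -cat1s all_cat all_seq1 all_map.
  apply/andP; split.
    by rewrite -fsize1 -[X in _ == X]addn0.
  apply: sub_all Hf => c /eqP Hc.
  apply/eqP; apply: etrans (_ : fsize c.1 + fsize [:: Node c.2] = _)%N => //.
  by rewrite fsize1 !tsize_node addnS Hc.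
Qed.

Lemma eq_big_all n (I : Type) (P : pred I) (r : seq I) (F G : I -> Ar n) :
  all P r -> (forall i, P i -> F i = G i) ->
  \sum_(i <- r) F i = \sum_(i <- r) G i.
Proof.
move=> Pr FG; elim: r Pr => [|i r IH] /=; first by rewrite !big_nil.
by case/andP=> Pi Pr; rewrite !big_cons (FG i Pi) (IH Pr).
Qed.

(** The bound on [g] is there because [genval] is correct only while its fuel lasts; [cop_size]
    keeps both factors in that range. *)
Lemma tmap_rword_Top n (gv : forest -> option (mu n) -> Ar n) rw f :
  (forall g v, (fsize g <= fsize f)%N -> gv g v = Top g (genpoly v)) ->
  tmap_rword gv rw f = Top f (wrd (rev rw)).
Proof.
elim: rw f => [|l rw IH] f Hgv.
  by rewrite /= wrd0; case: f {Hgv} => // t f; rewrite Top1.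
have -> : wrd (rev (l :: rw)) = wrd (rev rw) * wrd [:: l].
  by rewrite wrdM rev_cons cats1.
apply: etrans (esym (Top_cop _ _ _)) => /=.
apply: eq_big_all (cop_size f) _ => c /eqP Hc.
rewrite IH; last first.
  by move=> g v Hg; apply: Hgv; apply: leq_trans Hg _; rewrite -Hc leq_addr.
congr (_ * _).
have [lT gvE] : linear (@Top n c.2) /\
    forall v, gv c.2 v = Top c.2 (genpoly v).
  by split=> [|v]; [exact: Top_linear|rewrite Hgv // -Hc leq_addl].
rewrite letter_gens; apply: etrans (esym (linmap_sum lT _ _)).
by apply: eq_bigr => d _; rewrite gvE; apply: esym (linmapZ lT _ _).
Qed.

Lemma genval_Top n k f (v : option (mu n)) :
  (fsize f <= k)%N -> genval k f v = Top f (genpoly v).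
Proof.
elim: k f v => [|k IH] [|[g] f] v //.
case: f => [|t f].
  rewrite fsize1 tsize_node ltnS => Hg; case: v => [s|]; last by rewrite Top_Z.
  case: g Hg => [_|t g Hg]; first by rewrite (Top_leaf (Some s)).
  rewrite [genval _ _ _]/= (IH (t :: g) (Some s) Hg) /Rops (Top_gen t g (Some s)) (Top_node_gen t g (Some s)).
  by rewrite Rinv_gap.
move=> Hk.
(* The other factor has at least one vertex, so each of the two fits in the fuel [k]. *)
have Ht : (fsize [:: Node g] <= k)%N.
  move: Hk; rewrite fsize1 !fsize_cons; case: t => h.
  by rewrite (tsize_node h) addSn addnS ltnS; apply: leq_trans; apply: leq_addr.
have Hr : (fsize (t :: f) <= k)%N.
  move: Hk; rewrite (fsize_cons (Node g)) tsize_node addSn ltnS.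
  by apply: leq_trans; apply: leq_addl.
rewrite [genval _ _ _]/= (IH (t :: f) v Hr).
have -> : @Top n (Node g :: t :: f) (genpoly v) =
          Top [:: Node g] (Top (t :: f) (genpoly v)) by [].
apply: eq_linear => [||u]; [exact: lin_is_linear|exact: Top_linear|].
rewrite lin_wrd tmap_rword_Top ?revK // => h w Hh.
by apply: IH; apply: leq_trans Ht.
Qed.

Lemma tmap_Top n f (p : Ar n) : tmap f p = Top f p.
Proof.
move: p; apply: eq_linear => [||u]; [exact: lin_is_linear|exact: Top_linear|].
rewrite /tmap lin_wrd tmap_rword_Top ?revK // => h w Hh.
exact: genval_Top.
Qed.

(** * The diamond product *)

(** An inductive form of the condition on [msupp], suited to extending facts from words by
    linearity. *)
Inductive span n (Q : pred (word n)) : Ar n -> Prop :=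
| span0 : span Q 0
| span_cons a u p : Q u -> span Q p -> span Q (a *: wrd u + p).

Lemma span_comb n (Q : pred (word n)) a p q :
  span Q p -> span Q q -> span Q (a *: p + q).
Proof.
move=> Qp Qq; elim: Qp => [|b u p' Qu _ IH].
  by rewrite (scaler0 _ a) (add0r q).
have -> : a *: (b *: wrd u + p') + q = (a * b) *: wrd u + (a *: p' + q).
  have key (A : lalgType rat) (w t t' : A) :
    a *: (b *: w + t) + t' = (a * b) *: w + (a *: t + t') by nc_ring.
  exact: key.
exact: span_cons.
Qed.

Lemma span_wrd n (Q : pred (word n)) u : Q u -> span Q (wrd u).
Proof.
move=> Qu; have -> : wrd u = 1 *: wrd u + 0 by rewrite scale1r addr0.
by apply: span_cons => //; apply: span0.
Qed.

Lemma span_add n (Q : pred (word n)) p q : span Q p -> span Q q -> span Q (p + q).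
Proof. by move=> Qp Qq; rewrite -(scale1r p); apply: span_comb. Qed.

Lemma span_opp n (Q : pred (word n)) p : span Q p -> span Q (- p).
Proof.
move=> Qp; rewrite -scaleN1r -[_ *: p]addr0.
by apply: span_comb => //; apply: span0.
Qed.

Lemma span_ind_linear n (Q : pred (word n)) (P : Ar n -> Prop) :
  (forall a p q, P p -> P q -> P (a *: p + q)) -> P 0 ->
  (forall u, Q u -> P (wrd u)) -> forall p, span Q p -> P p.
Proof. by move=> PD P0 Pw p; elim=> [|a u q Qu _]; auto. Qed.

Lemma span_mulwrd n (Q Q' : pred (word n)) v p :
  (forall u, Q u -> Q' (u ++ v)) -> span Q p -> span Q' (p * wrd v).
Proof.
move=> QQ'; move: p; apply: span_ind_linear => [a p q Qp Qq||u Qu].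
- by rewrite (comb_mull a p q); exact: (span_comb a Qp Qq).
- by rewrite mul0r; apply: span0.
- by rewrite wrdM; apply/span_wrd/QQ'.
Qed.

Lemma span_supp n (Q : pred (word n)) p :
  span Q p -> forall k, k \in msupp p -> Q (fmonom_val k).
Proof.
move=> Qp k; rewrite -mcoeff_neq0; apply: contraR => nQk; apply/eqP.
elim: Qp => [|a u q Qu _ IH]; first exact: mcoeff0.
rewrite (mcoeff_scalar k a (wrd u) q) IH mcoeffU1.
rewrite (_ : (FMonom u == k) = false) ?mulr0 ?addr0 //.
by apply/negbTE; apply: contra nQk => /eqP <-.
Qed.

Lemma supp_span n (Q : pred (word n)) p :
  (forall k, k \in msupp p -> Q (fmonom_val k)) -> span Q p.
Proof.
move=> H; rewrite (monalgE p) big_seq.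
elim/big_ind: _ => [||k /H Qk]; [exact: span0|exact: span_add|].
have -> : << p@_k *g k >> = p@_k *: wrd (fmonom_val k) + 0.
  by rewrite addr0 /wrd fmK -mul_malgC malgM_def fgmulUU mulr1 mul1m.
by apply: span_cons => //; apply: span0.
Qed.

Definition a1 n : pred (word n) := all (fun l => (l == None) || (l == Some 0)).

Lemma a1_cat n (u v : word n) : a1 (u ++ v) = a1 u && a1 v.
Proof. exact: all_cat. Qed.

Lemma a1_rcons n (u : word n) l : a1 (rcons u l) = a1 u && a1 [:: l].
Proof. by rewrite -cats1 a1_cat. Qed.

Lemma span_mulX n (p : Ar n) : span (@a1 n) p -> span (@a1 n) (p * X n).
Proof. by apply: span_mulwrd => u Qu; rewrite a1_cat Qu. Qed.

Lemma span_mulY n (p : Ar n) : span (@a1 n) p -> span (@a1 n) (p * Y 0).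
Proof. by apply: span_mulwrd => u Qu; rewrite a1_cat Qu. Qed.

Lemma span_mulZ n (p : Ar n) : span (@a1 n) p -> span (@a1 n) (p * Z n).
Proof.
move=> Qp; rewrite /Z (mulrDr p (X n)).
by apply: span_add; [apply: span_mulX|apply: span_mulY].
Qed.

(** * The map psi_s on A_1 *)

Definition subst_y n (s : mu n) (l : letter n) : letter n :=
  if l is Some _ then Some s else None.

(** [Mword] turns only the first y into y_s; [Iword_acc] then passes s on to every later y, as these
    have exponent 0. *)
Lemma Iword_M n (s : mu n) u :
  a1 u -> Iword_acc 0 (Mword s u) = map (subst_y s) u.
Proof.
have Ia v : a1 v -> Iword_acc s v = map (subst_y s) v.
  elim: v => //= -[t|] v IH /=; last by move=> av; rewrite IH.
  by case/andP=> /eqP [->] av; rewrite addr0 IH.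
elim: u => //= -[t|] u IH /=; last by move=> au; rewrite IH.
by case/andP=> /eqP [->] au; rewrite add0r addr0 Ia.
Qed.

Lemma phi_wrd n (u : word n) : phi (wrd u) = phi_word u.
Proof. exact: lin_wrd. Qed.

Lemma phi_word_rcons n (u : word n) l :
  phi_word (rcons u l) = phi_word u * phi_letter l.
Proof. by rewrite /phi_word -cats1 big_cat big_seq1. Qed.

Lemma psi_wrd n (s : mu n) u :
  a1 u -> psi s (wrd u) = phi_word (map (subst_y s) u).
Proof. by move=> au; rewrite /psi /Mmap lin_wrd /Imap lin_wrd Iword_M // phi_wrd. Qed.

Lemma psi_linear n (s : mu n) : linear (psi s).
Proof.
move=> a p q; rewrite /psi /Mmap (lin_is_linear _ a p q).
by rewrite /Imap (lin_is_linear _ a); apply: lin_is_linear.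
Qed.

Lemma psi_mul n (s : mu n) p l : a1 [:: l] -> span (@a1 n) p ->
  psi s (p * wrd [:: l]) = psi s p * phi_letter (subst_y s l).
Proof.
move=> al; have lP := psi_linear s.
move: p; apply: span_ind_linear => [a p q Hp Hq||u au].
- exact: (@intertwine_comb (Ar n) (psi s) (wrd [:: l])
            (phi_letter (subst_y s l)) lP a p q Hp Hq).
- exact: (@intertwine0 (Ar n) (psi s) (wrd [:: l])
            (phi_letter (subst_y s l)) lP).
rewrite wrdM cats1 !psi_wrd //; first by rewrite map_rcons phi_word_rcons.
by rewrite a1_rcons au.
Qed.

Lemma phi_word_a1 n (u : word n) : a1 u -> span (@a1 n) (phi_word u).
Proof.
elim/last_ind: u => [_|u l IH].
  by rewrite /phi_word big_nil -wrd0; apply: span_wrd.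
rewrite a1_rcons => /andP [/IH Hu]; rewrite /a1 all_seq1.
rewrite phi_word_rcons; case: l => [t /eqP [->]|_]; last exact: span_mulZ.
rewrite [phi_letter _]/= /delta eqxx scale0r add0r mulrN.
by apply: span_opp; apply: span_mulY.
Qed.

(** phi(x) = x + y, and on A_1 the map [psi s] turns a final x + y into z + (delta(s) y_s - y) =
    z_s^delta. *)
Lemma psi_phi_X n (s : mu n) u : a1 u ->
  psi s (phi (wrd (rcons u None))) = psi s (phi (wrd u)) * Zd s.
Proof.
move=> au; rewrite !phi_wrd phi_word_rcons [phi_letter _]/=.
have := phi_word_a1 au; move: (phi_word u) => p Hp.
rewrite /Z (mulrDr p (X n)) (linmapD (psi_linear s)).
apply: etrans (f_equal2 +%R (psi_mul s (l := None) _ Hp)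
                            (psi_mul s (l := Some 0) _ Hp)) _ => //=.
have key (A : lalgType rat) (e x y y' : A) :
  e * (x + y) + e * (y' - y) = e * (x + y') by nc_ring.
exact: key.
Qed.

Lemma psi_phi_Y n (s : mu n) u : a1 u ->
  psi s (phi (wrd (rcons u (Some 0)))) = psi s (phi (wrd u)) * (Z n - Zd s).
Proof.
move=> au; rewrite !phi_wrd phi_word_rcons [phi_letter _]/=.
rewrite /delta eqxx scale0r add0r.
have := phi_word_a1 au; move: (phi_word u) => p Hp.
rewrite mulrN (linmapN (psi_linear s)).
apply: etrans (f_equal -%R (psi_mul s (l := Some 0) _ Hp)) _ => //=.
have key (A : lalgType rat) (e x y y' : A) :
  - (e * (y' - y)) = e * (x + y - (x + y')) by nc_ring.
exact: key.
Qed.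

(** One step of the recursion, freed from the fuel: [d1] shortens v and [d2] shortens w. Each takes
    the last letter of the other word, which the rules may change. *)
Definition dia_step n (d1 d2 : letter n -> Ar n) (a b : letter n) : Ar n :=
  match a, b with
  | None, None => d1 None * X n - d2 (Some 0) * X n
  | None, Some t =>
      if t == 0 then d1 (Some t) * X n + d2 None * Y 0
      else d1 (Some t) * X n + (d1 None + d1 (Some t)) * Y t - d2 (Some 0) * Y t
  | Some a', None =>
      if a' == 0 then d1 None * Y 0 + d2 (Some a') * X n else 0
  | Some a', Some t =>
      if a' == 0 then
        if t == 0 then d1 (Some t) * Y 0 - d2 None * Y 0
        else d1 (Some t) * Y 0 - (d1 None + d1 (Some t)) * Y t
             + d2 (Some a') * Y t
      else 0
  end.

Lemma dia_cons n k (s : mu n) a b rv rw :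
  dia k.+1 s (a :: rv) (b :: rw) =
  dia_step (fun c => dia k s rv (c :: rw)) (fun c => dia k s (c :: rv) rw) a b.
Proof. by case: a => [a|]; case: b => [b|]. Qed.

Lemma eq_dia_step n (d1 d2 d1' d2' : letter n -> Ar n) a b :
  d1 =1 d1' -> d2 =1 d2' -> dia_step d1 d2 a b = dia_step d1' d2' a b.
Proof.
move=> e1 e2; rewrite /dia_step.
case: a => [a|]; case: b => [b|]; rewrite ?(e1 None) ?(e1 (Some b)) ?(e2 None).
- by rewrite (e2 (Some a)).
- by rewrite (e2 (Some a)).
- by rewrite (e2 (Some 0)).
- by rewrite (e2 (Some 0)).
Qed.

Lemma dia_fuel n (s : mu n) k k' rv rw :
  (size rv + size rw <= k)%N -> (size rv + size rw <= k')%N ->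
  dia k s rv rw = dia k' s rv rw.
Proof.
elim: k k' rv rw => [|k IH] k' [|a rv]; [|move=> rw; rewrite addSn ltn0| |].
- by case: k'.
- by [].
- by case: k'.
case=> [|b rw]; first by case: k'.
case: k' => [|k']; first by move=> _; rewrite addSn ltn0.
rewrite !addSn !addnS !ltnS !dia_cons => Hk Hk'.
by apply: eq_dia_step => c; apply: IH; rewrite /= ?addnS ?addSn.
Qed.

Definition diar n (s : mu n) (rv rw : word n) : Ar n :=
  dia (size rv + size rw) s rv rw.

Lemma diar0 n (s : mu n) rw : diar s [::] rw = wrd (rev rw).
Proof. by rewrite /diar; case: (size [::] + size rw)%N. Qed.

Lemma diar_nil n (s : mu n) rv :
  diar s rv [::] = psi s (phi (wrd (rev rv))).
Proof.
case: rv => [|a rv]; last by rewrite /diar; case: (size (a :: rv) + size [::])%N.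
by rewrite diar0 phi_wrd /phi_word big_nil -wrd0 psi_wrd // /phi_word big_nil wrd0.
Qed.

Lemma diar_cons n (s : mu n) a b rv rw :
  diar s (a :: rv) (b :: rw) =
  dia_step (fun c => diar s rv (c :: rw)) (fun c => diar s (c :: rv) rw) a b.
Proof.
rewrite {1}/diar [size (a :: _)]/= [size (b :: _)]/= addSn dia_cons.
apply: eq_dia_step => c; first by [].
by apply: dia_fuel; rewrite /= ?addSn ?addnS.
Qed.

(** * Relations of the diamond product in z and y *)

Lemma a1_rev n (rv : word n) : a1 (rev rv) = a1 rv.
Proof. exact: all_rev. Qed.

Lemma diar_nil_X n (s : mu n) rv : a1 rv ->
  diar s (None :: rv) [::] = diar s rv [::] * Zd s.
Proof. by rewrite -a1_rev !diar_nil rev_cons; apply: psi_phi_X. Qed.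

Lemma diar_nil_Y n (s : mu n) rv : a1 rv ->
  diar s (Some 0 :: rv) [::] = diar s rv [::] * (Z n - Zd s).
Proof. by rewrite -a1_rev !diar_nil rev_cons; apply: psi_phi_Y. Qed.

(** In the sum of the rules for vx and vy, all terms with w shortened and all terms ending in y_t
    cancel. *)
Lemma diar_Zl n (s : mu n) rv rw : a1 rv ->
  diar s (None :: rv) rw + diar s (Some 0 :: rv) rw = diar s rv rw * Z n.
Proof.
case: rw => [|b rw] ar.
  rewrite (diar_nil_X s ar) (diar_nil_Y s ar).
  have key (A : lalgType rat) (e z t : A) : e * t + e * (z - t) = e * z by nc_ring.
  exact: key.
rewrite !diar_cons /dia_step eqxx; case: b => [t|]; last first.
  have key (A : lalgType rat) (d e x y : A) :
    d * x - e * x + (d * y + e * x) = d * (x + y) by nc_ring.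
  exact: key.
case: eqP => _.
  have key (A : lalgType rat) (d e x y : A) :
    d * x + e * y + (d * y - e * y) = d * (x + y) by nc_ring.
  exact: key.
have key (A : lalgType rat) (d d' e x y yt : A) :
  d * x + (d' + d) * yt - e * yt + (d * y - (d' + d) * yt + e * yt) = d * (x + y).
  by nc_ring.
exact: key.
Qed.

(** Induction on v. For vy, the rules for wx and wy add up to (v <> wz) y + (vy <> w) x - (vx <> w)
    y, where v <> wz = vx <> w + vy <> w by induction and [diar_Zl]. *)
Lemma diar_Zr n (s : mu n) rv rw : a1 rv ->
  diar s rv (None :: rw) + diar s rv (Some 0 :: rw) = diar s rv rw * Z n.
Proof.
elim: rv => [_|a rv IH].
  rewrite !diar0 !rev_cons -!cats1 -!wrdM; exact: (esym (mulrDr _ _ _)).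
rewrite -cat1s a1_cat => /andP [aa ar].
have ZY : diar s (Some 0 :: rv) (None :: rw) + diar s (Some 0 :: rv) (Some 0 :: rw)
    = diar s (Some 0 :: rv) rw * Z n.
  have := diar_Zl s rw ar; have := IH ar; rewrite !diar_cons /dia_step eqxx.
  have key (A : lalgType rat) (dN dS e f g x y : A) :
    dN + dS = g -> f + e = g ->
    dN * y + e * x + (dS * y - f * y) = e * (x + y).
    by move=> <- fe; rewrite -[dN](addrK dS) -fe; nc_ring.
  exact: key.
case: a aa => [a|_]; first by rewrite /a1 all_seq1 => /eqP [->]; exact: ZY.
(* The case vx is obtained by subtracting the case vy from the case vz, which [diar_Zl] reduces to
   v. *)
have := diar_Zl s (None :: rw) ar; have := diar_Zl s (Some 0 :: rw) ar.
have := diar_Zl s rw ar; have := IH ar; move: ZY.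
have key (A : lalgType rat) (A1 A2 B1 B2 dN dS e f g z : A) :
  B1 + B2 = e * z -> dN + dS = g -> f + e = g ->
  A2 + B2 = dS * z -> A1 + B1 = dN * z -> A1 + A2 = f * z.
  move=> eB eg fe e2 e1; rewrite -[A1](addrK B1) -[A2](addrK B2) e1 e2.
  rewrite -[f](addrK e) fe -eg.
  have -> : dN * z - B1 + (dS * z - B2) = (dN + dS) * z - (B1 + B2) by nc_ring.
  by rewrite eB; nc_ring.
exact: key.
Qed.

Lemma diamond_linear_l n (s : mu n) q : linear (fun p : Ar n => diamond s p q).
Proof. by move=> a p p'; apply: lin_is_linear. Qed.

Lemma diamond_wrd_l n (s : mu n) u q :
  diamond s (wrd u) q = lin (fun w => diamond_word s u w) q.
Proof. exact: lin_wrd. Qed.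

Lemma diamond_linear_r n (s : mu n) p : linear (@diamond n s p).
Proof.
elim/Ar_word_ind: p => [|c p p' lp lp'|u] a q q'.
- have l0 r := linmap0 (diamond_linear_l s r).
  have key (A : lalgType rat) (d0 d1 d2 : A) :
    d0 = 0 -> d1 = 0 -> d2 = 0 -> d0 = a *: d1 + d2.
    by move=> -> -> ->; rewrite scaler0 addr0.
  exact: (key _ _ _ _ (l0 _) (l0 _) (l0 _)).
- have lc r := diamond_linear_l s r c p p'.
  have key (A : lalgType rat) (e e1 e2 d1 d2 d1' d2' d d' : A) :
    d = a *: d1 + d2 -> d' = a *: d1' + d2' ->
    e = c *: d + d' -> e1 = c *: d1 + d1' -> e2 = c *: d2 + d2' ->
    e = a *: e1 + e2.
    move=> -> -> -> -> ->; rewrite !scalerDr !scalerA [a * c]mulrC.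
    by rewrite addrACA.
  exact: (key _ _ _ _ _ _ _ _ _ _ (lp a q q') (lp' a q q') (lc _) (lc _) (lc _)).
- by rewrite !diamond_wrd_l; apply: lin_is_linear.
Qed.

Lemma diamond_wrd n (s : mu n) u w :
  diamond s (wrd u) (wrd w) = diar s (rev u) (rev w).
Proof. by rewrite diamond_wrd_l lin_wrd /diamond_word /diar !size_rev. Qed.

Lemma diamond_wrd_letter n (s : mu n) u w l :
  diamond s (wrd u) (wrd w * wrd [:: l]) = diar s (rev u) (l :: rev w).
Proof. by rewrite wrdM diamond_wrd rev_cat. Qed.

Lemma diamond_letter_wrd n (s : mu n) u w l :
  diamond s (wrd u * wrd [:: l]) (wrd w) = diar s (l :: rev u) (rev w).
Proof. by rewrite wrdM diamond_wrd rev_cat. Qed.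

(** For z the correction vanishes and this is [diar_Zr]; for x it is the defining rule, as z - x =
    y; for x + y_t with t different from 1 it is the sum of the rules for wx and w y_t. *)
Lemma diamond_mulY_gen n (s : mu n) p q v : span (@a1 n) p ->
  diamond s (p * Y 0) (q * genpoly v) =
  diamond s (p * Y 0) q * genpoly v +
  diamond s p (q * genpoly v) * (Z n - genpoly v).
Proof.
move=> Hp; have lr := @diamond_linear_r n s; have ll := @diamond_linear_l n s.
elim/Ar_word_ind: q => [|a q q' Hq Hq'|w].
- rewrite mul0r.
  have key (A : lalgType rat) (d d' t t' : A) :
    d = 0 -> d' = 0 -> d = d * t + d' * t'.
    by move=> -> ->; rewrite !mul0r addr0.
  exact: (key _ _ _ _ _ (linmap0 (lr _)) (linmap0 (lr _))).
- exact: (@leibniz_comb (Ar n) (diamond s (p * Y 0)) (diamond s p) (genpoly v)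
            (Z n - genpoly v) (lr _) (lr _) a q q' Hq Hq').
move: p Hp; apply: span_ind_linear => [a p p' Hp Hp'||u au].
- exact: (@bilinear_leibniz_comb (Ar n) (@diamond n s) (Y 0) (genpoly v)
            (Z n - genpoly v) ll a p p' (wrd w) Hp Hp').
- rewrite mul0r.
  have key (A : lalgType rat) (d0 d d' t t' : A) :
    d0 = 0 -> d = 0 -> d' = 0 -> d0 = d * t + d' * t'.
    by move=> -> -> ->; rewrite !mul0r addr0.
  exact: (key _ _ _ _ _ _ (linmap0 (ll _)) (linmap0 (ll _)) (linmap0 (ll _))).
have ar : a1 (rev u) by rewrite a1_rev.
rewrite wrdM (diamond_wrd s (u ++ _) w) rev_cat /=.
have lDr p t : diamond s p (wrd w * (X n + Y t)) =
    diamond s p (wrd w * X n) + diamond s p (wrd w * Y t).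
  by rewrite (mulrDr (wrd w) (X n)); exact: (linmapD (lr p)).
have lE1 l : diamond s (wrd (u ++ [:: Some 0])) (wrd w * wrd [:: l]) =
    diar s (Some 0 :: rev u) (l :: rev w).
  by rewrite diamond_wrd_letter rev_cat.
have lE0 l := diamond_wrd_letter s u w l.
have genX : diamond s (wrd (u ++ [:: Some 0])) (wrd w * X n) =
    diar s (rev u) (None :: rev w) * Y 0 + diar s (Some 0 :: rev u) (rev w) * X n.
  by apply: etrans (lE1 None) _; rewrite diar_cons /dia_step eqxx.
case: v => [t|]; last first.
  have e := etrans (lDr (wrd (u ++ [:: Some 0])) 0)
    (etrans (f_equal2 +%R (lE1 None) (lE1 (Some 0))) (diar_Zr s (rv := Some 0 :: rev u) (rev w) _)).
  apply: etrans (e _) _; first by rewrite -cat1s a1_cat ar.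
  have key (A : lalgType rat) (d d' z : A) : d' * z = d' * z + d * (z - z) by nc_ring.
  exact: key.
have [->|t0] := eqVneq t 0.
  rewrite [genpoly _]/= -X_gen genX (lE0 None).
  have key (A : lalgType rat) (d e x y : A) :
    d * y + e * x = e * x + d * (x + y - x) by nc_ring.
  exact: key.
rewrite [genpoly _]/= (Zd_neq0 t0).
apply: etrans (etrans (lDr (wrd (u ++ [:: Some 0])) t)
  (f_equal2 +%R genX (lE1 (Some t)))) _.
have e0 := etrans (lDr (wrd u) t) (f_equal2 +%R (lE0 None) (lE0 (Some t))).
rewrite diar_cons /dia_step eqxx (negbTE t0).
have key (A : lalgType rat) (d dN dt e x y yt : A) : d = dN + dt ->
  dN * y + e * x + (dt * y - (dN + dt) * yt + e * yt) =
  e * (x + yt) + d * (x + y - (x + yt)) by move=> ->; nc_ring.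
exact: (key _ _ _ _ _ _ _ _ e0).
Qed.

Lemma diamond_mulZ n (s : mu n) p q : span (@a1 n) p ->
  diamond s (p * Z n) q = diamond s p q * Z n.
Proof.
move=> Hp; move: q; apply: eq_linear => [||w].
- exact: diamond_linear_r.
- move=> a q q'; rewrite (diamond_linear_r s p a q q').
  exact: comb_mull.
have ll := diamond_linear_l s (wrd w).
move: p Hp; apply: span_ind_linear => [a p p' Hp Hp'||u au].
- exact: (@intertwine_comb (Ar n) _ (Z n) (Z n) ll a p p' Hp Hp').
- exact: (@intertwine0 (Ar n) _ (Z n) (Z n) ll).
rewrite [in LHS]/Z (mulrDr (wrd u) (X n)).
apply: etrans (linmapD ll _ _) _.
apply: etrans (f_equal2 +%R (diamond_letter_wrd s u w None)
                            (diamond_letter_wrd s u w (Some 0))) _.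
rewrite (diamond_wrd s u w).
by apply: diar_Zl; rewrite a1_rev.
Qed.

Lemma diamond_mulY1 n (s : mu n) p : span (@a1 n) p ->
  diamond s (p * Y 0) 1 = diamond s p 1 * (Z n - Zd s).
Proof.
have ll := diamond_linear_l s (1 : Ar n).
move: p; apply: span_ind_linear => [a p p' Hp Hp'||u au].
- exact: (@intertwine_comb (Ar n) _ (Y 0) (Z n - Zd s) ll a p p' Hp Hp').
- exact: (@intertwine0 (Ar n) _ (Y 0) (Z n - Zd s) ll).
rewrite -wrd0 (diamond_wrd s u).
apply: etrans (diamond_letter_wrd s u [::] (Some 0)) _.
by apply: diar_nil_Y; rewrite a1_rev.
Qed.

Lemma diamond1 n (s : mu n) (q : Ar n) : diamond s 1 q = q.
Proof.
move: q; rewrite -wrd0; apply: eq_linear => [||w] //.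
  exact: diamond_linear_r.
by rewrite diamond_wrd diar0 revK.
Qed.

(** For the root 1 the factors z_s^delta and z - z_s^delta are x and y, so each letter of the left
    argument reproduces itself. *)
Lemma diamond0_1 n (p : Ar n) : span (@a1 n) p -> diamond 0 p 1 = p.
Proof.
have ll := diamond_linear_l 0 (1 : Ar n).
move: p; apply: span_ind_linear => [a p q Hp Hq||u].
- by apply: etrans (ll a p q) _; rewrite Hp Hq.
- exact: (linmap0 ll).
rewrite -wrd0 diamond_wrd.
elim/last_ind: u => [|u l IH]; first by rewrite diar0.
rewrite a1_rcons rev_rcons -[in RHS]cats1 -wrdM => /andP [au].
have ar : a1 (rev u) by rewrite a1_rev.
rewrite -[in RHS](IH au) /a1 all_seq1; case: l => [t /eqP [->]|_].
  rewrite (diar_nil_Y 0 ar); congr (_ * _); rewrite -X_gen.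
  have key (A : lalgType rat) (x y : A) : x + y - x = y by nc_ring.
  exact: key.
by rewrite (diar_nil_X 0 ar) -X_gen.
Qed.

(** * From operators to diamond products *)

Lemma ext_diamond n (D : Ar n -> Ar n) (s : mu n) (G : Ar n) :
  linear D -> span (@a1 n) G ->
  (forall w, D (Zd s * w) = Zd s * diamond s G w) ->
  forall w, ext D (Zd s * w) = Zd s * diamond s (G * Y 0) w.
Proof.
move=> lD HG DG; have lE := ext_linear D.
(* Both sides satisfy the same recursion in w, by [ext_gen] and [diamond_mulY_gen], and agree at w =
   1 by [diamond_mulY1]. *)
apply: Ar_gen_ind => [a w w' Hw Hw'||w v IH].
- rewrite (comb_mulr a w w') (diamond_linear_r s (G * Y 0) a w w').
  apply: etrans (lE a _ _) _.
  apply: etrans (f_equal2 (fun e e' => a *: e + e') Hw Hw') _.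
  exact: esym (comb_mulr _ _ _ _).
- rewrite mulr1 (diamond_mulY1 s HG) (mulrA (Zd s)) -(DG 1) mulr1.
  exact: (@ext_gen1 (Ar n) (Z n) _ (@genpoly n) (@ext n) (@ext1 n) (@ext_gen n)
            D (Some s) lD).
rewrite (diamond_mulY_gen s w v HG) (mulrA (Zd s) w).
apply: etrans (ext_gen (Zd s * w) v lD) _.
have DGw := DG (w * genpoly v); rewrite (mulrA (Zd s) w) in DGw.
have key (A : lalgType rat) (e d z b b' t t' : A) : e = z * b -> d = z * b' ->
  e * t + d * t' = z * (b * t + b' * t') by move=> -> ->; nc_ring.
exact: (key _ _ _ _ _ _ _ _ IH DGw).
Qed.

(** [G] spells out the construction of [D] as a polynomial in z and y, hence one [G] serves every
    s. *)
Lemma rep_diamond n (D : Ar n -> Ar n) : repAr D ->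
  exists2 G, span (@a1 n) G &
    forall s w, D (Zd s * w) = Zd s * diamond s G w.
Proof.
have lr D' : repAr D' -> linear D' by apply: rep_linear; apply: ext_linear.
elim=> {D} [|a D1 D2 _ [G1 H1 E1] _ [G2 H2 E2]|D _ [G HG E]|D rD [G HG E]
           |D1 D2 eqD _ [G HG E]].
- exists 1; first by rewrite -wrd0; apply: span_wrd.
  by move=> s w; rewrite diamond1.
- exists (a *: G1 + G2); first exact: span_comb.
  move=> s w; rewrite E1 E2.
  apply: etrans (esym (comb_mulr a _ _ _)) _; congr (_ * _).
  exact: esym (diamond_linear_l s w a G1 G2).
- exists (G * Z n); first exact: span_mulZ.
  by move=> s w; rewrite E (diamond_mulZ s w HG) mulrA.
- exists (G * Y 0); first exact: span_mulY.
  by move=> s; apply: ext_diamond => //; apply: lr.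
- by exists G => // s w; rewrite -eqD.
Qed.

Definition a11 n : pred (word n) :=
  fun u => a1 u && ((u == [::]) || (last None u == Some 0)).

Lemma span_a11_a1 n (p : Ar n) : span (@a11 n) p -> span (@a1 n) p.
Proof. by elim=> [|a u q /andP [au _] _]; [exact: span0|exact: span_cons]. Qed.

Lemma inA11P n (p : Ar n) : inA11 p <-> span (@a11 n) p.
Proof.
split=> [H|H k kp].
  apply: supp_span => k /H [ak lk]; apply/andP; split=> //.
  by case: lk => ->; rewrite ?eqxx ?orbT.
by case/andP: (span_supp H kp) => ak /orP [] /eqP e; split=> //; [left|right].
Qed.

(** A nonempty forest acts as some [ext D], so its polynomial has a final factor y and lies in
    A_1^1; the empty forest gives 1. *)
Lemma tmap_diamond n f :
  exists2 G : Ar n, span (@a11 n) G &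
    forall s w, tmap f (Zd s * w) = Zd s * diamond s G w.
Proof.
case: f => [|t f].
  exists 1; first by rewrite -wrd0; apply: span_wrd.
  by move=> s w; rewrite tmap_Top diamond1.
have [D rD TD] := @Top_rep_ext n t f; have [G HG DG] := rep_diamond rD.
have lD : linear D by apply: rep_linear rD; apply: ext_linear.
exists (G * Y 0).
  apply: span_mulwrd HG => u au.
  by rewrite /a11 a1_cat au cats1 last_rcons eqxx orbT.
by move=> s w; rewrite tmap_Top TD; apply: ext_diamond.
Qed.

Lemma tmapH_diamond n (h : Hel) :
  exists2 G : Ar n, span (@a11 n) G &
    forall s w, tmapH h (Zd s * w) = Zd s * diamond s G w.
Proof.
elim: h => [|[a f] h [G HG EG]].
  exists 0; first exact: span0.
  move=> s w; rewrite /tmapH big_nil.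
  by rewrite [diamond s 0 w](linmap0 (diamond_linear_l s w)) mulr0.
have [F HF EF] := @tmap_diamond n f; exists (a *: F + G); first exact: span_comb.
move=> s w; rewrite /tmapH big_cons.
apply: etrans (f_equal2 (fun e e' => a *: e + e') (EF s w) (EG s w)) _.
apply: etrans (esym (comb_mulr a _ _ _)) _; congr (_ * _).
exact: esym (diamond_linear_l s w a F G).
Qed.

(* r = n.+1; f ranges over H (formal Q-combinations of forests);
   S = antipode, h~ = tmapH h, z_s^delta = Zd s, G <>_s w = diamond s G w. *)
Theorem mainTheorem3 (n : nat) (f : Hel) :
  exists! G : Ar n, inA11 G /\
    forall (s : mu n) (w : Ar n),
      tmapH (antipode f) (Zd s * w) = Zd s * diamond s G w.
Proof.
have [G HG EG] := @tmapH_diamond n (antipode f).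
exists G; split; first by split=> //; apply/inA11P.
(* z_1^delta is x, which can be cancelled on the left. *)
move=> G' [/inA11P HG' EG']; apply: mulX_inj.
rewrite -{1}(diamond0_1 (span_a11_a1 HG)) -{1}(diamond0_1 (span_a11_a1 HG')).
by rewrite X_gen; apply: etrans (esym (EG 0 1)) (EG' 0 1).
Qed.
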